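(* Let $f$ be a field, $L$ a Lie $f$-algebra, $T$ a representation of $L$ in an $f$-space $V$ with basis $(e_i)_{i\in I}$, $I$ linearly ordered, and let $D$ be the diagram of $T$ corresponding to this basis. For $\alpha\in I^n$ put $$e_\alpha^{\mathrm{sym}}=\sum_{\beta\in S_n(\alpha)}e_\beta,\qquad e_{i_1\dots i_n}=e_{i_1}\otimes\dots\otimes e_{i_n},$$ where $S_n(\alpha)$ is the orbit of $\alpha$ under permutations of its entries by the symmetric group $S_n$, and let $S_nV$ be the subspace of $V^{\otimes n}$ with the basis $(e_\alpha^{\mathrm{sym}})_{\alpha\in S^nI}$, where $S^nI=\{(i_1,\dots,i_n)\in I^n: i_1\le\dots\le i_n\}$. Then $S_nD$ is the diagram of the subrepresentation $S_nT$ of $L$ in $S_nV\subseteq V^{\otimes n}$, corresponding to this basis.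
   Context: $L^\ast=\mathrm{Hom}_f(L,f)$. The diagram of a representation $T$ of $L$ corresponding to a basis $(e_i)_{i\in I}$ is the directed graph (loops allowed, no multiple edges) with vertex set $I$ having an edge $(i,j)$ iff the linear form $w(i,j)\in L^\ast$, $w(i,j)(l)=$ the coefficient of $e_j$ in $T(l)e_i$, is non-zero; the edge is then labeled by (has weight) $w(i,j)$. When there is no edge $(i,j)$, $w(i,j)=0$. A reduced weighted directed graph is one without multiple edges and with non-zero weights. For a reduced weighted directed graph $G$ with linearly ordered vertex set $V(G)$, $S_nG$ is the reduced weighted directed graph with vertex set $\{(v_1,\dots,v_n)\in V(G)^n: v_1\le\dots\le v_n\}$ and the following edges. For a vertex $A$ let $v_i(A)$ be its $i$-th entry and $\mathrm{Pr}_i(A)$ the sequence of length $n-1$ obtained by erasing the $i$-th entry. For $A\ne B$, the edge $(A,B)$ exists iff for some $i,j$ one has $\mathrm{Pr}_i(A)=\mathrm{Pr}_j(B)$, there is an edge $(v_i(A),v_j(B))$ in $G$, and $(\#\text{ of entries equal to }v_j(B)\text{ in }B)\cdot w(v_i(A),v_j(B))\ne 0$; this element is then the weight of $(A,B)$. The loop $(A,A)$ exists iff $\sum_{i=1}^n w(v_i(A),v_i(A))\neq 0$, and this sum is then its weight. *)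

(* Defs.v *)
From HB Require Import structures.
From mathcomp Require Import all_boot all_order all_algebra all_fingroup.
From mathcomp Require Import generic_quotient ring_quotient finmap.
From mathcomp.multinomials Require Import monalg.
From mathcomp Require Import boolp functions.

Set Implicit Arguments.
Unset Strict Implicit.
Unset Printing Implicit Defensive.

Import Order.TTheory GRing.Theory.
Local Open Scope ring_scope.

HB.mixin Record Lmodule_isLieAlgebra (f : fieldType) L of GRing.Lmodule f L := {
  lie : L -> L -> L;
  lie_linearl : forall z : L, linear (fun x => lie x z);
  lie_linearr : forall x : L, linear (lie x);
  liexx : forall x : L, lie x x = 0;
  lie_jacobi : forall x y z : L,
    lie x (lie y z) + lie y (lie z x) + lie z (lie x y) = 0
}.

#[short(type="lieAlgType")]
HB.structure Definition LieAlgebra (f : fieldType) :=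
  {L of GRing.Lmodule f L & Lmodule_isLieAlgebra f L}.

Record lie_rep (f : fieldType) (L : lieAlgType f) (V : lmodType f) := LieRep {
  rep_act :> L -> V -> V;
  rep_linear : forall l, linear (rep_act l);
  rep_linear_lie : forall v, linear (fun l => rep_act l v);
  rep_lie : forall x y v,
    rep_act (lie x y) v = rep_act x (rep_act y v) - rep_act y (rep_act x v)
}.

Section DualSpace.
Variables (f : fieldType) (L : lmodType f).

Definition linear_form : {pred L -> f^o} := fun phi => `[< linear phi >].

Lemma linear_form_submod : submod_closed linear_form.
Proof.
split=> [|a p q /asboolP lp /asboolP lq]; apply/asboolP => b x y.
  by rewrite -[0]/(fun _ : L => 0 : f^o) /= scaler0 addr0.
change (a *: p (b *: x + y) + q (b *: x + y)
        = b *: (a *: p x + q x) + (a *: p y + q y)).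
rewrite lp lq !scalerDr !scalerA (mulrC a b) addrACA.
by rewrite -!addrA.
Qed.

HB.instance Definition _ :=
  GRing.isSubmodClosed.Build f (L -> f^o) linear_form linear_form_submod.

Record dual_space := DualSpace {
  dual_fun :> L -> f^o;
  dual_funP : dual_fun \in linear_form
}.
HB.instance Definition _ := [isSub for dual_fun].
HB.instance Definition _ := [Choice of dual_space by <:].
HB.instance Definition _ := [SubChoice_isSubLmodule of dual_space by <:].

End DualSpace.

(* {malg f[J]} is only used as the free f-space of finitely supported functions *)
(* J -> f.                                                                     *)
Section Bases.
Variables (f : fieldType) (W : lmodType f) (J : choiceType).
Implicit Types (u : J -> W) (c : {malg f[J]}).

Definition lincomb u c : W := \sum_(j <- msupp c) c@_j *: u j.

Lemma lincombEw u (d : {fset J}) c : (msupp c `<=` d)%fset ->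
  lincomb u c = \sum_(j <- d) c@_j *: u j.
Proof.
move=> le; rewrite /lincomb (big_fset_incl _ le) //= => x _ /mcoeff_outdom ->.
by rewrite scale0r.
Qed.

Lemma lincomb_is_linear u : linear (lincomb u).
Proof.
move=> a c1 c2; pose d := (msupp c1 `|` msupp c2)%fset.
have h1 : (msupp c1 `<=` d)%fset by rewrite fsubsetUl.
have h2 : (msupp c2 `<=` d)%fset by rewrite fsubsetUr.
have h3 : (msupp (a *: c1 + c2) `<=` d)%fset.
  apply: fsubset_trans (msuppD_le _ _) _.
  by apply: fsetUSS => //; apply: msuppZ_le.
rewrite (lincombEw u h1) (lincombEw u h2) (lincombEw u h3).
rewrite scaler_sumr -big_split /=; apply: eq_bigr => j _.
by rewrite mcoeffD mcoeffZ scalerDl scalerA.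
Qed.

HB.instance Definition _ u :=
  GRing.isLinear.Build f {malg f[J]} W *:%R (lincomb u) (lincomb_is_linear u).

Lemma lincombU u j : lincomb u << j >> = u j.
Proof.
by rewrite (lincombEw u msuppU_le) big_seq_fset1 mcoeffUU scale1r.
Qed.

Definition lspan u : {pred W} := fun w => `[< exists c, w = lincomb u c >].

Lemma lspan_submod u : submod_closed (lspan u).
Proof.
split=> [|a x y /asboolP[c ->] /asboolP[d ->]]; apply/asboolP.
  by exists 0; rewrite linear0.
by exists (a *: c + d); rewrite linearP.
Qed.

HB.instance Definition _ u :=
  GRing.isSubmodClosed.Build f W (lspan u) (lspan_submod u).

Lemma mem_lspan u j : u j \in lspan u.
Proof. by apply/asboolP; exists << j >>; rewrite lincombU. Qed.

Definition is_basis u :=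
  (forall c, lincomb u c = 0 -> c = 0) /\ (forall w, w \in lspan u).

Record hamel_basis := HamelBasis {
  basis_vec :> J -> W;
  basis_vecP : is_basis basis_vec
}.

Lemma basis_coord_ex (e : hamel_basis) w : exists c, w = lincomb e c.
Proof. by apply/asboolP; case: (basis_vecP e) => _; apply. Qed.

Definition basis_coord (e : hamel_basis) w : {malg f[J]} :=
  sval (cid (basis_coord_ex e w)).

Lemma basis_coordK (e : hamel_basis) w : lincomb e (basis_coord e w) = w.
Proof. by rewrite /basis_coord; case: cid. Qed.

Lemma lincomb_inj (e : hamel_basis) : injective (lincomb e).
Proof.
move=> c d cd; apply/eqP; rewrite -subr_eq0; apply/eqP.
by apply: (basis_vecP e).1; rewrite linearB /= cd subrr.
Qed.

Lemma basis_coord_is_linear (e : hamel_basis) : linear (basis_coord e).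
Proof.
by move=> a x y; apply: (@lincomb_inj e); rewrite linearP /= !basis_coordK.
Qed.

End Bases.

Section Graphs.
Variables (X : Type) (M : zmodType).

(* Reducedness is built in: edges form a relation (so there are no multiple    *)
(* edges), weights of edges are non-zero, and following the usual convention   *)
(* the weight of a pair that is not an edge is 0.                              *)
Record rwdgraph := RWDGraph {
  edge : rel X;
  weight : X -> X -> M;
  edgeE : forall x y, edge x y = (weight x y != 0)
}.

End Graphs.

Section Diagram.
Variables (f : fieldType) (L : lieAlgType f) (V : lmodType f) (I : choiceType).
Variables (T : lie_rep L V) (e : hamel_basis V I).

Definition diagram_form i j : L -> f^o :=
  fun l => (basis_coord e (T l (e i)))@_j.

Lemma diagram_formP i j : diagram_form i j \in @linear_form f L.
Proof.
apply/asboolP => a x y.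
by rewrite /diagram_form rep_linear_lie basis_coord_is_linear mcoeffD mcoeffZ.
Qed.

Definition diagram_weight i j : dual_space L := DualSpace (diagram_formP i j).

Definition diagram : rwdgraph I (dual_space L) :=
  @RWDGraph I (dual_space L) (fun i j => diagram_weight i j != 0)
    diagram_weight (fun _ _ => erefl).

End Diagram.

Section SymIndex.
Variables (d : Order.disp_t) (I : orderType d) (n : nat).

Record sym_index := SymIndex {
  sym_tuple :> n.-tuple I;
  sym_sorted : sorted <=%O sym_tuple
}.
HB.instance Definition _ := [isSub for sym_tuple].
HB.instance Definition _ := [Choice of sym_index by <:].

End SymIndex.

Section EraseEntry.
Variables (I : eqType) (n : nat).
Implicit Types (A : n.-tuple I) (i : 'I_n).

Definition erase_entry i A : n.-1.-tuple I :=
  [tuple tnth A (lift i k) | k < n.-1].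

Lemma count_erase_entry x i A :
  count_mem x A = ((tnth A i == x) + count_mem x (erase_entry i A))%N.
Proof.
rewrite /erase_entry; case: n i A => [[]//|m] i A.
have cE p (t : p.-tuple I) :
    count_mem x t = (\sum_(k < p) (tnth t k == x))%N.
  rewrite -sum1_count big_tuple [RHS](bigID (fun k => tnth t k == x)) /=.
  rewrite [X in (_ + X)%N]big1 ?addn0; last by move=> k /negPf ->.
  by apply: eq_bigr => k ->.
rewrite !cE (bigD1_ord i) //=; congr addn.
by apply: eq_bigr => k _; rewrite tnth_mktuple.
Qed.

End EraseEntry.

Section SymGraph.
Variables (d : Order.disp_t) (I : orderType d) (M : zmodType).
Variables (G : rwdgraph I M) (n : nat).
Implicit Types (A B : sym_index I n) (p : 'I_n * 'I_n).

Definition sym_value A B p : M :=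
  weight G (tnth A p.1) (tnth B p.2) *+ count_mem (tnth B p.2) B.

Definition sym_witness A B p : bool :=
  [&& erase_entry p.1 A == erase_entry p.2 B,
      edge G (tnth A p.1) (tnth B p.2) & sym_value A B p != 0].

Definition sym_edge A B : bool :=
  if A == B then \sum_(i < n) weight G (tnth A i) (tnth A i) != 0
  else [exists p, sym_witness A B p].

(* The value does not depend on the witness picked, see sym_value_uniq.        *)
Definition sym_weight A B : M :=
  if A == B then \sum_(i < n) weight G (tnth A i) (tnth A i)
  else if [pick p | sym_witness A B p] is Some p then sym_value A B p else 0.

Lemma sym_value_uniq A B p q :
    A != B -> sym_witness A B p -> sym_witness A B q ->
  sym_value A B p = sym_value A B q.
Proof.
move=> AB /andP[/eqP Ep _] /andP[/eqP Eq _].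
case: p q Ep Eq => [i j] [i' j'] /= Ep Eq.
have cP x : (count_mem x A + (tnth B j == x)
             = count_mem x B + (tnth A i == x))%N.
  by rewrite (count_erase_entry x i) (count_erase_entry x j B) Ep addnAC [RHS]addnAC; congr addn; rewrite addnC.
have cQ x : (count_mem x A + (tnth B j' == x)
             = count_mem x B + (tnth A i' == x))%N.
  by rewrite (count_erase_entry x i') (count_erase_entry x j' B) Eq addnAC [RHS]addnAC; congr addn; rewrite addnC.
have ab : tnth A i != tnth B j.
  apply: contra AB => /eqP ab; apply/eqP/val_inj/val_inj/(@le_sorted_eq _ I);
    [exact: sym_sorted|exact: sym_sorted|].
  by apply/allP => x _ /=; move: (cP x); rewrite ab => /addIn ->.
have a_eq : tnth A i' = tnth A i.
  have := cQ (tnth A i); have := cP (tnth A i).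
  rewrite eqxx [tnth B j == _]eq_sym (negPf ab) addn0 => ->.
  by rewrite -addnA => /addnI; case: (tnth A i' =P tnth A i).
have b_eq : tnth B j' = tnth B j.
  have := cP (tnth B j); have := cQ (tnth B j).
  by rewrite a_eq => <-; rewrite eqxx => /addnI; case: eqP.
by rewrite /sym_value /= a_eq b_eq.
Qed.

Lemma sym_edgeE A B : sym_edge A B = (sym_weight A B != 0).
Proof.
rewrite /sym_edge /sym_weight; case: eqVneq => // _.
case: pickP => [p pP|no].
  by have /and3P[_ _ ->] := pP; apply/existsP; exists p.
by rewrite eqxx; apply/negbTE/existsPn => p; rewrite no.
Qed.

Definition sym_graph : rwdgraph (sym_index I n) M := RWDGraph sym_edgeE.

End SymGraph.

Section TensorPower.
Variables (f : fieldType) (V : lmodType f) (n : nat).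
Local Notation family := {ffun 'I_n -> V}.
Implicit Types (v : family) (i : 'I_n).

Definition set_entry v i (x : V) : family :=
  [ffun k => if k == i then x else v k].

Definition multilinear (U : lmodType f) (g : family -> U) :=
  forall v i, linear (fun x => g (set_entry v i x)).

Definition tensor_relator (r : family * 'I_n * f * V * V) : {malg f[family]} :=
  let: (v, i, a, x, y) := r in
  << set_entry v i (a *: x + y) >>
  - (a *: << set_entry v i x >> + << set_entry v i y >>).

(* The n-fold tensor power of V: the free f-space on V^n modulo the            *)
(* multilinearity relations; for n = 0 it is f itself.                         *)
Definition tensor_power : Type := Quotient.quot (lspan tensor_relator).
HB.instance Definition _ := GRing.Zmodule.on tensor_power.
HB.instance Definition _ := EqQuotient.on tensor_power.

Definition tensor_class (c : {malg f[family]}) : tensor_power :=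
  \pi_(tensor_power)%qT c.

Lemma tensor_classP c c' :
  tensor_class c = tensor_class c' <-> c - c' \in lspan tensor_relator.
Proof.
by rewrite Quotient.idealrBE; split=> /eqP.
Qed.

Lemma tensor_class_is_zmod : zmod_morphism tensor_class.
Proof. by move=> x y; rewrite /tensor_class !piE. Qed.
HB.instance Definition _ := GRing.isZmodMorphism.Build _ _ tensor_class
  tensor_class_is_zmod.

Definition tensor_scale (a : f) (w : tensor_power) : tensor_power :=
  tensor_class (a *: repr w).

Lemma tensor_reprK w : tensor_class (repr w) = w.
Proof. exact: reprK. Qed.

Lemma tensor_scaleE a c : tensor_scale a (tensor_class c) = tensor_class (a *: c).
Proof.
apply/tensor_classP; rewrite -scalerBr rpredZ //.
by apply/tensor_classP; rewrite tensor_reprK.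
Qed.

Fact tensor_scalerA a b w :
  tensor_scale a (tensor_scale b w) = tensor_scale (a * b) w.
Proof. by rewrite -[w]tensor_reprK !tensor_scaleE scalerA. Qed.
Fact tensor_scale1r : left_id 1 tensor_scale.
Proof. by move=> w; rewrite -[w]tensor_reprK !tensor_scaleE scale1r. Qed.
Fact tensor_scalerDr : right_distributive tensor_scale +%R.
Proof.
move=> a w w'; rewrite -[w]tensor_reprK -[w']tensor_reprK -raddfD.
by rewrite !tensor_scaleE scalerDr raddfD.
Qed.
Fact tensor_scalerDl w : {morph tensor_scale^~ w : a b / a + b}.
Proof.
by move=> a b; rewrite /= -[w]tensor_reprK !tensor_scaleE scalerDl raddfD.
Qed.
HB.instance Definition _ := GRing.Zmodule_isLmodule.Build f tensor_power
  tensor_scalerA tensor_scale1r tensor_scalerDr tensor_scalerDl.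

Lemma tensor_class_is_scalable : scalable tensor_class.
Proof. by move=> a c; rewrite -[RHS]/(tensor_scale _ _) tensor_scaleE. Qed.
HB.instance Definition _ := GRing.isScalable.Build f _ _ _ tensor_class
  tensor_class_is_scalable.

Definition tensor v : tensor_power := tensor_class << v >>.

Lemma tensor_multilinear : multilinear tensor.
Proof.
move=> v i a x y; rewrite /= /tensor -linearP; apply/tensor_classP.
exact: (mem_lspan tensor_relator (v, i, a, x, y)).
Qed.

Lemma tensor_ind (P : tensor_power -> Prop) :
    P 0 -> (forall a v w, P w -> P (a *: tensor v + w)) -> forall w, P w.
Proof.
move=> P0 PS w; rewrite -[w]tensor_reprK (monalgE (repr w)) linear_sum /=.
elim: (enum_fset _) => [|v s IHs]; first by rewrite big_nil.
rewrite big_cons; set c := (repr w)@_v.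
have -> : << c *g v >> = c *: << v >> :> {malg f[family]}.
  by apply/malgP => k; rewrite mcoeffZ !mcoeffU mulr_natr.
by rewrite linearZ; apply: PS.
Qed.

Lemma tensor_linear_eq (U : lmodType f) (g h : tensor_power -> U) :
    linear g -> linear h -> (forall v, g (tensor v) = h (tensor v)) ->
  forall w, g w = h w.
Proof.
move=> lg lh gh; elim/tensor_ind => [|a v w IH]; last by rewrite lg lh gh IH.
have z0 (k : tensor_power -> U) : linear k -> k 0 = 0.
  by move=> lk; have := lk (-1) 0 0; rewrite scaler0 addr0 scaleN1r addNr.
by rewrite !z0.
Qed.

Definition tensor_lift (U : lmodType f) (g : family -> U) (w : tensor_power) : U :=
  lincomb g (repr w).

Section Lift.
Variables (U : lmodType f) (g : family -> U).
Hypothesis g_multi : multilinear g.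

Lemma tensor_lift_class c : tensor_lift g (tensor_class c) = lincomb g c.
Proof.
have /tensor_classP/asboolP[r rE] := tensor_reprK (tensor_class c).
apply/eqP; rewrite /tensor_lift -subr_eq0 -linearB /= rE [X in lincomb g X]/lincomb linear_sum.
apply/eqP/big1 => -[[[[v i] a] x] y] _ /=.
rewrite linearZ linearB linearP /= !lincombU.
by rewrite (g_multi v i a x y) subrr scaler0.
Qed.

Lemma tensor_liftE v : tensor_lift g (tensor v) = g v.
Proof. by rewrite tensor_lift_class lincombU. Qed.

Lemma tensor_lift_is_linear : linear (tensor_lift g).
Proof.
move=> a x y; rewrite -[x]tensor_reprK -[y]tensor_reprK -linearP.
by rewrite !tensor_lift_class linearP.
Qed.

End Lift.
End TensorPower.

Section LinearMaps.
Variables (f : fieldType) (W U : lmodType f).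

Lemma linear_comb (a : f) (g h : W -> U) :
  linear g -> linear h -> linear (fun w => a *: g w + h w).
Proof.
move=> lg lh b x y; rewrite lg lh !scalerDr !scalerA (mulrC a b).
by rewrite addrACA.
Qed.

Lemma linear_commutator (g h : W -> W) :
  linear g -> linear h -> linear (fun w => g (h w) - h (g w)).
Proof.
by move=> lg lh b x y; rewrite !(lg, lh) opprD scalerBr addrACA.
Qed.

End LinearMaps.

Section TensorRep.
Variables (f : fieldType) (L : lieAlgType f) (V : lmodType f).
Variables (T : lie_rep L V) (n : nat).
Implicit Types (l : L) (v : {ffun 'I_n -> V}).

Definition tensor_deriv l v : tensor_power V n :=
  \sum_(i < n) tensor (set_entry v i (T l (v i))).

Lemma set_entry2 v i x y : set_entry (set_entry v i x) i y = set_entry v i y.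
Proof. by apply/ffunP => k; rewrite !ffunE; case: eqP. Qed.

Lemma set_entryC v i j x y : i != j ->
  set_entry (set_entry v i x) j y = set_entry (set_entry v j y) i x.
Proof.
move=> ij; apply/ffunP => k; rewrite !ffunE.
by case: (eqVneq k j) => // ->; rewrite eq_sym (negPf ij).
Qed.

Lemma tensor_deriv_multilinear l : multilinear (tensor_deriv l).
Proof.
move=> v i a x y; rewrite /tensor_deriv scaler_sumr -big_split /=.
apply: eq_bigr => k _; rewrite !ffunE; case: eqVneq => [->|ki].
  by rewrite !set_entry2 rep_linear tensor_multilinear.
by rewrite ![set_entry (set_entry v i _) k _]set_entryC 1?eq_sym //
  tensor_multilinear.
Qed.

Definition tensor_act l : tensor_power V n -> tensor_power V n :=
  tensor_lift (tensor_deriv l).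

Lemma tensor_actE l v : tensor_act l (tensor v) = tensor_deriv l v.
Proof. exact/tensor_liftE/tensor_deriv_multilinear. Qed.

Lemma tensor_act_linear l : linear (tensor_act l).
Proof. exact/tensor_lift_is_linear/tensor_deriv_multilinear. Qed.

HB.instance Definition _ l := GRing.isLinear.Build f _ _ _ (tensor_act l)
  (tensor_act_linear l).

Lemma tensor_act_linear_lie w : linear (fun l => tensor_act l w).
Proof.
move=> a x y; move: w; apply: tensor_linear_eq => [|b w w'|v].
- exact: tensor_act_linear.
- exact: (linear_comb a (tensor_act_linear x) (tensor_act_linear y)).
rewrite !tensor_actE /tensor_deriv scaler_sumr -big_split /=.
by apply: eq_bigr => i _; rewrite rep_linear_lie tensor_multilinear.
Qed.

Lemma tensor_act_lie x y w :
  tensor_act (lie x y) w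
  = tensor_act x (tensor_act y w) - tensor_act y (tensor_act x w).
Proof.
move: w; apply: tensor_linear_eq => [|b w w'|v].
- exact: tensor_act_linear.
- exact: (linear_commutator (tensor_act_linear x) (tensor_act_linear y)).
have actE p q : tensor_act p (tensor_act q (tensor v))
  = \sum_(i < n) tensor (set_entry v i (T p (T q (v i))))
    + \sum_(i < n) \sum_(j < n | j != i)
        tensor (set_entry (set_entry v i (T q (v i))) j (T p (v j))).
  rewrite tensor_actE /tensor_deriv linear_sum -big_split /=.
  apply: eq_bigr => i _; rewrite tensor_actE /tensor_deriv (bigD1 i) //=.
  rewrite !ffunE eqxx set_entry2; congr (_ + _).
  by apply: eq_bigr => j ji; rewrite !ffunE (negPf ji).
rewrite !actE opprD addrACA.
have -> : \sum_(i < n) \sum_(j < n | j != i)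
            tensor (set_entry (set_entry v i (T x (v i))) j (T y (v j)))
        = \sum_(i < n) \sum_(j < n | j != i)
            tensor (set_entry (set_entry v i (T y (v i))) j (T x (v j))).
  rewrite (exchange_big_dep xpredT) //=; apply: eq_bigr => i _.
  by apply: eq_big => j; rewrite eq_sym // => ij; rewrite set_entryC // eq_sym.
rewrite subrr addr0 tensor_actE /tensor_deriv -sumrB; apply: eq_bigr => i _.
rewrite rep_lie -[_ - _]addrC -scaleN1r tensor_multilinear scaleN1r.
by rewrite addrC.
Qed.

Definition tensor_rep : lie_rep L (tensor_power V n) :=
  LieRep tensor_act_linear tensor_act_linear_lie tensor_act_lie.

End TensorRep.

Section Subspace.
Variables (f : fieldType) (W : lmodType f) (S : submodClosed W).

Record subspace := Subspace {
  subspace_val :> W;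
  subspace_valP : subspace_val \in S
}.
HB.instance Definition _ := [isSub for subspace_val].
HB.instance Definition _ := [Choice of subspace by <:].
HB.instance Definition _ := [SubChoice_isSubLmodule of subspace by <:].

Lemma subspace_val_linear : linear subspace_val.
Proof. by move=> a x y; rewrite -[subspace_val _]/(\val _) linearP. Qed.

Lemma subspace_valB : {morph subspace_val : x y / x - y}.
Proof. by move=> x y; rewrite -[subspace_val _]/(\val _) linearB. Qed.

Variables (L : lieAlgType f) (T : lie_rep L W).

Definition stable := forall l w, w \in S -> T l w \in S.

Hypothesis T_stable : stable.

Definition subrep_act (l : L) (w : subspace) : subspace :=
  Subspace (T_stable l (subspace_valP w)).

Lemma subrep_act_linear l : linear (subrep_act l).
Proof.
move=> a x y; apply: val_inj; rewrite [RHS]subspace_val_linear.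
rewrite -[LHS]/(T l (subspace_val (a *: x + y))) subspace_val_linear.
exact: rep_linear.
Qed.

Lemma subrep_act_linear_lie w : linear (fun l => subrep_act l w).
Proof.
move=> a x y; apply: val_inj; rewrite [RHS]subspace_val_linear.
exact: (rep_linear_lie T (subspace_val w)).
Qed.

Lemma subrep_act_lie x y w : subrep_act (lie x y) w
  = subrep_act x (subrep_act y w) - subrep_act y (subrep_act x w).
Proof. by apply: val_inj; rewrite [RHS]subspace_valB; exact: rep_lie. Qed.

Definition subrep : lie_rep L subspace :=
  LieRep subrep_act_linear subrep_act_linear_lie subrep_act_lie.

End Subspace.

Section SymPower.
Variables (f : fieldType) (V : lmodType f) (d : Order.disp_t) (I : orderType d).
Variables (e : I -> V) (n : nat).

Definition sym_orbit (a : n.-tuple I) : {fset n.-tuple I} :=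
  [fset [tuple tnth a (s k) | k < n] | s : 'S_n in [set: 'S_n]]%fset.

Definition basis_tensor (a : n.-tuple I) : tensor_power V n :=
  tensor [ffun k => e (tnth a k)].

Definition sym_tensor (a : n.-tuple I) : tensor_power V n :=
  \sum_(b <- sym_orbit a) basis_tensor b.

Definition sym_family (a : sym_index I n) : tensor_power V n := sym_tensor a.

Definition sym_power := subspace (lspan sym_family).
HB.instance Definition _ := GRing.Lmodule.on sym_power.

Definition sym_vec (a : sym_index I n) : sym_power :=
  Subspace (mem_lspan sym_family a).

End SymPower.

Arguments sym_family {f V d I} e n a.
Arguments sym_power {f V d I} e n.
Arguments sym_vec {f V d I} e n a.

(* Main.v *)
(* The coefficient of e_g in T(l) e_a^sym counts the pairs (b, k), with b in   *)
(* the orbit of a, such that b and g agree off position k, weighted by         *)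
(* w(b_k, g_k).  Writing x = b_k and y = g_k, such a b exists iff the          *)
(* multisets x + g and y + a coincide, and it is then unique; so the           *)
(* coefficient is the sum over the entries y of g and the distinct values x of *)
(* a with x + g = y + a of w(x, y).  This is invariant under permutations of   *)
(* g, which gives stability.  For sorted g = a it reduces to the diagonal      *)
(* sum, and for sorted g <> a at most one pair (x, y) of values occurs, with y *)
(* repeated as often as it occurs in g.                                        *)

Require Import Defs.
From mathcomp Require Import all_boot all_order all_algebra.
From HB Require Import structures.
From mathcomp Require Import all_fingroup finmap.
From mathcomp.multinomials Require Import monalg.
From mathcomp Require Import boolp.

Set Implicit Arguments.
Unset Strict Implicit.
Unset Printing Implicit Defensive.

Import Order.TTheory GRing.Theory.
Local Open Scope ring_scope.

(** Both weights are brought to the same double sum over entries [y] of [B] and distinct values [x]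
    of [A] with [x :: B] and [y :: A] equal as multisets. On the representation side, [T l] acts on
    one tensor position at a time, so a basis tensor of the orbit contributes to the coefficient of
    a given index only through positions off which the two agree; [sum_orbit_erase] reparametrises
    these contributions by the replaced value, giving [tensor_coord_act_sym]. On the graph side,
    [sym_weightE] proves the formula from the definition by witnesses. The functionals
    [tensor_coord] make coefficients in the tensor power meaningful and show that the symmetric
    tensors are independent. Stability follows because the double sum is symmetric in the target
    index and, by [lspan_sym_family], symmetric coefficients characterise the span. *)

Section Erasure.
Variables (I : eqType) (n : nat).
Implicit Types (A B : n.-tuple I) (i k : 'I_n).

Lemma perm_eq1 (x y : I) : perm_eq [:: x] [:: y] = (x == y).
Proof. by apply/idP/eqP => [/perm_small_eq-/(_ isT)[]|->]. Qed.

Lemma perm_erase_entry i A : perm_eq A (tnth A i :: erase_entry i A).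
Proof. by apply/allP => x _ /=; rewrite (count_erase_entry x i A). Qed.

Lemma erase_entryP k A B :
  reflect (forall m, m != k -> tnth A m = tnth B m)
          (erase_entry k A == erase_entry k B).
Proof.
apply: (iffP eqP) => [AB m mk|AB].
  have [j mE] : exists j, m = lift k j.
    by case: (unliftP k m) mk => [j ->|->]; [exists j | rewrite eqxx].
  by have := congr1 (fun t => tnth t j) AB; rewrite !tnth_mktuple mE.
by apply: eq_from_tnth => j; rewrite !tnth_mktuple AB // eq_sym neq_lift.
Qed.

End Erasure.

(** * Orbits, sorted representatives and one-entry replacements *)

Section Orbits.
Variables (d : Order.disp_t) (I : orderType d) (n : nat).
Implicit Types (a b g : n.-tuple I) (A B : sym_index I n).

Lemma mem_sym_orbit a b : (b \in sym_orbit a) = perm_eq b a.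
Proof.
apply/imfsetP/tuple_permP => -[s]; first by move=> _ ->; exists s.
by move=> bE; exists s; [rewrite inE | apply: val_inj].
Qed.

Lemma sym_index_perm_eq A B : perm_eq A B -> A = B.
Proof.
move=> AB; apply/val_inj/val_inj/(@le_sorted_eq _ I) => //; exact: sym_sorted.
Qed.

Definition sort_index a : sym_index I n :=
  @SymIndex d I n [tuple of sort <=%O a] (sort_sorted le_total a).

Lemma perm_sort_index a : perm_eq (sort_index a) a.
Proof. by rewrite perm_sort. Qed.

Lemma sort_index_eq a B : (sort_index a == B) = perm_eq a B.
Proof.
apply/eqP/idP => [<-|aB]; first by rewrite perm_sym perm_sort_index.
by apply: sym_index_perm_eq; rewrite (perm_trans (perm_sort_index a)).
Qed.

Lemma tnth_sorted (a : n.-tuple I) :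
  sorted <=%O a -> {homo tnth a : i j / (i <= j)%N >-> (i <= j)%O}.
Proof.
move=> sa i j ij; have := tnth a i => x0; rewrite !(tnth_nth x0).
by apply: (sorted_leq_nth le_trans le_refl) => //; rewrite inE size_tuple.
Qed.

Lemma sorted_erase_entry i a : sorted <=%O a -> sorted <=%O (erase_entry i a).
Proof.
move=> sa; rewrite /erase_entry /=.
apply: (@homo_sorted _ _ _ (fun p q : 'I_n.-1 => (p <= q)%N)).
  by move=> p q pq; apply: tnth_sorted => //=; rewrite leq_bump2.
by have := iota_sorted 0 n.-1; rewrite -val_enum_ord sorted_map.
Qed.

(** Adding [tnth g k] to both multisets removes the erasure; the resulting condition depends on [g]
    only through its multiset and the one value [tnth g k]. *)
Lemma perm_cons_erase (x : I) k a g :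
  perm_eq (x :: erase_entry k g) a = perm_eq (x :: g) (tnth g k :: a).
Proof.
rewrite -(perm_cons (tnth g k)).
suff /permPl <- : perm_eq (x :: g) (tnth g k :: x :: erase_entry k g) by [].
by apply/seq.permP => p; rewrite [LHS]/= (seq.permP (perm_erase_entry k g) p) /= addnCA.
Qed.

(** A tuple agreeing with [g] off [k] is determined by its entry at [k], so reading that entry is
    injective on the indices of the left sum. [undup] is needed because equal entries of [a] give
    the same tuple. *)
Lemma sum_orbit_erase (M : zmodType) (w : I -> I -> M) a g k :
  \sum_(b <- sym_orbit a | erase_entry k b == erase_entry k g)
     w (tnth b k) (tnth g k)
  = \sum_(x <- undup a | perm_eq (x :: g) (tnth g k :: a)) w x (tnth g k).
Proof.
rewrite -big_filter -[RHS]big_filter.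
rewrite -(big_map (fun b => tnth b k) xpredT (fun x => w x (tnth g k))).
apply/perm_big/uniq_perm => [||x].
- rewrite map_inj_in_uniq; first exact/filter_uniq/fset_uniq.
  move=> b c; rewrite !mem_filter => /andP[/erase_entryP bg _].
  move=> /andP[/erase_entryP cg _] bc; apply: eq_from_tnth => m.
  by have [->//|mk] := eqVneq m k; rewrite bg ?cg.
- exact/filter_uniq/undup_uniq.
rewrite mem_filter mem_undup -perm_cons_erase; apply/mapP/andP => [[b]|[xg xa]].
  rewrite mem_filter mem_sym_orbit => /andP[/eqP bg ba] ->; split.
    by rewrite -bg -(permPl (perm_erase_entry k b)).
  by rewrite -(perm_mem ba) mem_tnth.
(* Surjectivity: the preimage of [x] is [g] with its entry at [k] overwritten. *)
pose b := [tuple if m == k then x else tnth g m | m < n].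
have bk : tnth b k = x by rewrite tnth_mktuple eqxx.
have bg : erase_entry k b = erase_entry k g.
  by apply/eqP/erase_entryP => m /negPf mk; rewrite tnth_mktuple mk.
exists b => //; rewrite mem_filter bg eqxx mem_sym_orbit.
by rewrite (permPl (perm_erase_entry k b)) bk bg.
Qed.

End Orbits.

(** * The weights of the symmetric power graph as a multiset sum *)

Section SymGraphWeight.
Variables (d : Order.disp_t) (I : orderType d) (M : zmodType).
Variables (G : rwdgraph I M) (n : nat).
Implicit Types (A B : sym_index I n).

(** Distinct multisets that differ by one exchange determine the exchanged values, so only one pair
    [(x, y)] survives; its [y] is met once per occurrence in [B], which is the multiplicity in
    [sym_value]. *)
Lemma sum_exchange_erase A B i j :
    A != B -> erase_entry i A = erase_entry j B ->
  \sum_(y <- B) \sum_(x <- undup A | perm_eq (x :: B) (y :: A)) weight G x y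
  = sym_value G A B (i, j).
Proof.
move=> AB ij; set a := tnth A i; set b := tnth B j.
have aB : perm_eq (a :: B) (b :: A).
  by rewrite -perm_cons_erase -ij perm_sym perm_erase_entry.
have ab : a != b.
  apply: contraNneq AB => ab; move: aB.
  by rewrite ab perm_cons perm_sym => /sym_index_perm_eq ->.
have pE x y : perm_eq (x :: B) (y :: A) = (x == a) && (y == b).
  apply/idP/andP => [xy|[/eqP-> /eqP->] //].
  (* Comparing the two exchanges cancels [A] and [B]; since [a != b], the values [z = a] and [z = b]
     force [x = a] and [y = b]. *)
  have eq_count z : ((x == z) + (b == z) = (y == z) + (a == z))%N.
    move: (seq.permP xy (pred1 z)) (seq.permP aB (pred1 z)) => /= cxy cab.
    apply: (@addIn (count_mem z A)); rewrite -addnA -cab addnCA cxy.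
    by rewrite addnCA addnA.
  have := eq_count b; have := eq_count a.
  rewrite !eqxx [b == a]eq_sym (negPf ab).
  by case: (x == a); case: (y == b); case: (x == b); case: (y == a).
under eq_bigr => y _ do under eq_bigl => x do rewrite pE.
rewrite (bigID (pred1 b)) /= [X in _ + X]big1 ?addr0 => [|y /negPf yb]; last first.
  by rewrite big_pred0 // => x; rewrite yb andbF.
rewrite /sym_value /= -/a -/b -iter_addr_0 -(big_const_seq _ _ _ (pred1 b)).
apply: eq_bigr => y /eqP ->; under eq_bigl => x do rewrite eqxx andbT.
rewrite -big_filter filter_pred1_uniq ?undup_uniq ?mem_undup ?mem_tnth //.
by rewrite big_seq1.
Qed.

Lemma sym_weightE A B : sym_weight G A B =
  \sum_(y <- B) \sum_(x <- undup A | perm_eq (x :: B) (y :: A)) weight G x y.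
Proof.
have [<-|AB] := eqVneq A B.
  rewrite /sym_weight eqxx big_tuple; apply: eq_bigr => i _.
  under eq_bigl => x do rewrite (perm_cat2r A [:: x] [:: _]) perm_eq1.
  rewrite -big_filter filter_pred1_uniq ?undup_uniq ?mem_undup ?mem_tnth //.
  by rewrite big_seq1.
rewrite /sym_weight (negPf AB); case: pickP => [[i j] /and3P[/eqP ij _ _]|none].
  by rewrite (sum_exchange_erase AB ij).
(* Without a witness the weight is 0. If the erasures still match somewhere, then the edge is
   missing or the multiple of its weight vanishes, and the sum is 0 as well; otherwise the sum is
   empty. *)
have [/existsP[[i j] /= ij]|no] :=
  boolP [exists p, erase_entry p.1 A == erase_entry p.2 B].
  rewrite (sum_exchange_erase AB (eqP ij)).
  have := none (i, j); rewrite /sym_witness ij /= edgeE.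
  rewrite /sym_value; case: eqVneq => [->|_ /= /negbFE/eqP ->//].
  by rewrite mul0rn.
rewrite big1_seq // => y /andP[_ /tnthP[j ->]]; rewrite big1_seq // => x /andP[].
rewrite mem_undup => xy /tnthP[i xE]; case/existsP: no; exists (i, j).
(* Erasing from a sorted tuple leaves it sorted, so multiset equality of the erasures is
   equality. *)
apply/eqP/val_inj/(@le_sorted_eq _ I); try exact/sorted_erase_entry/sym_sorted.
have : perm_eq (x :: erase_entry j B) A by rewrite perm_cons_erase.
by rewrite perm_sym (permPl (perm_erase_entry i A)) -xE perm_cons.
Qed.

End SymGraphWeight.

(** * Evaluation of linear forms, as an additive map that commutes with sums of weights *)

Section DualEvaluation.
Variables (f : fieldType) (L : lmodType f) (l : L).

Definition dual_eval (phi : dual_space L) : f^o := phi l.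

Lemma dual_eval_is_zmod : zmod_morphism dual_eval.
Proof. by []. Qed.
HB.instance Definition _ :=
  GRing.isZmodMorphism.Build _ _ dual_eval dual_eval_is_zmod.

End DualEvaluation.

(** * Coordinates on the tensor power and the span of the symmetric tensors *)

Section BasisTensors.
Variables (f : fieldType) (V : lmodType f) (d : Order.disp_t) (I : orderType d).
Variables (e : hamel_basis V I) (n : nat).
Implicit Types (a b g : n.-tuple I).

Lemma basis_coordE j : basis_coord e (e j) = << j >>.
Proof. by apply: (@lincomb_inj _ _ _ e); rewrite basis_coordK lincombU. Qed.

(** The product of the dual-basis functionals indexed by the entries of [g]. *)
Definition tensor_coord_fun g (v : {ffun 'I_n -> V}) : f^o :=
  \prod_k (basis_coord e (v k))@_(tnth g k).

Lemma tensor_coord_fun_multilinear g : multilinear (tensor_coord_fun g).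
Proof.
move=> v i c x y.
have E z : tensor_coord_fun g (set_entry v i z) = (basis_coord e z)@_(tnth g i) *
    \prod_(k < n | k != i) (basis_coord e (v k))@_(tnth g k).
  rewrite /tensor_coord_fun (bigD1 i) //= !ffunE eqxx; congr (_ * _).
  by apply: eq_bigr => k /negPf ki; rewrite ffunE ki.
by rewrite !E basis_coord_is_linear mcoeffD mcoeffZ mulrDl -mulrA.
Qed.

Definition tensor_coord g : tensor_power V n -> f^o :=
  tensor_lift (tensor_coord_fun g).

HB.instance Definition _ g := GRing.isLinear.Build f _ _ _ (tensor_coord g)
  (tensor_lift_is_linear (tensor_coord_fun_multilinear g)).

Lemma tensor_coordE g v :
  tensor_coord g (tensor v) = \prod_k (basis_coord e (v k))@_(tnth g k).
Proof. exact: (tensor_liftE (tensor_coord_fun_multilinear g)). Qed.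

Lemma prod_eqtuple a b : \prod_k (tnth a k == tnth b k)%:R = (a == b)%:R :> f.
Proof.
case: (eqVneq a b) => [->|ab]; first by apply: big1 => k _; rewrite eqxx.
have [k abk] : exists k, tnth a k != tnth b k.
  apply/existsP; apply: contraR ab => /existsPn ab.
  by apply/eqP/eq_from_tnth => k; apply/eqP/negPn/ab.
by rewrite (bigD1 k) //= (negPf abk) mul0r.
Qed.

Lemma tensor_coord_basis a g : tensor_coord g (basis_tensor e a) = (a == g)%:R.
Proof.
rewrite tensor_coordE -prod_eqtuple; apply: eq_bigr => k _.
by rewrite ffunE basis_coordE mcoeffU.
Qed.

Lemma tensor_coord_lincomb g c :
  tensor_coord g (lincomb (basis_tensor (n := n) e) c) = c@_g.
Proof.
rewrite /lincomb linear_sum /= [in RHS](monalgE c) raddf_sum /=.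
apply: eq_bigr => a _.
by rewrite linearZ /= tensor_coord_basis mcoeffU -[RHS]mulr_natr.
Qed.

(** The orbit is a set, so [g] is hit at most once, and it is hit exactly when sorting it gives
    [A]. *)
Lemma tensor_coord_sym g (A : sym_index I n) :
  tensor_coord g (sym_family e n A) = (A == sort_index g)%:R.
Proof.
rewrite /sym_family /sym_tensor linear_sum /=.
under eq_bigr => a _ do rewrite tensor_coord_basis.
rewrite eq_sym sort_index_eq -mem_sym_orbit.
case: (boolP (g \in _)) => gA; last first.
  by rewrite big1_seq // => a /andP[_ aA]; case: eqVneq aA gA => // -> ->.
rewrite (big_rem g) //= eqxx big1_seq ?addr0 // => a /andP[_].
by rewrite mem_rem_uniq ?fset_uniq // inE => /andP[/negPf->].
Qed.

Lemma sym_coord_lincomb (B : sym_index I n) c :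
  tensor_coord B (lincomb (sym_family e n) c) = c@_B.
Proof.
rewrite /lincomb linear_sum /= [in RHS](monalgE c) raddf_sum /=.
apply: eq_bigr => A _.
rewrite linearZ /= tensor_coord_sym mcoeffU -[RHS]mulr_natr.
by have /eqP-> : sort_index B == B by rewrite sort_index_eq.
Qed.

(** Coefficients constant on orbits allow grouping the support by sorted representative, each group
    being a multiple of one symmetric tensor. *)
Lemma lspan_sym_family w :
    w \in lspan (basis_tensor (n := n) e) ->
    (forall a b, perm_eq a b -> tensor_coord a w = tensor_coord b w) ->
  w \in lspan (sym_family e n).
Proof.
move=> /asboolP[c ->] cperm.
have {}cperm a b : perm_eq a b -> c@_a = c@_b.
  by move=> /cperm; rewrite !tensor_coord_lincomb.
rewrite /lincomb (partition_big_imfset _ (@sort_index _ I n)) big_seq.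
apply: rpred_sum => B /imfsetP[a /= ac ->].
under eq_bigl => b do rewrite sort_index_eq.
have -> : \sum_(b <- msupp c | perm_eq b (sort_index a)) c@_b *: basis_tensor e b
   = c@_a *: sym_family e n (sort_index a).
  rewrite scaler_sumr -big_filter.
  (* The support contains the whole orbit of [a], since the coefficient there is constantly the
     non-zero [c@_a]. *)
  transitivity (\sum_(b <- sym_orbit (sort_index a)) c@_b *: basis_tensor e b).
    apply/perm_big/uniq_perm; rewrite ?filter_uniq ?fset_uniq // => b.
    rewrite mem_filter mem_sym_orbit andb_idr // => ba.
    rewrite -mcoeff_neq0 (cperm b a) ?mcoeff_neq0 //.
    exact: perm_trans ba (perm_sort_index a).
  rewrite [LHS]big_seq [RHS]big_seq; apply: eq_bigr => b.
  rewrite mem_sym_orbit => ba; rewrite (cperm b a) //.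
  exact: perm_trans ba (perm_sort_index a).
by apply/rpredZ/mem_lspan.
Qed.
End BasisTensors.

(** * The basis of the symmetric power and its coordinates *)

Section SymPowerBasis.
Variables (f : fieldType) (V : lmodType f) (d : Order.disp_t) (I : orderType d).
Variables (e : hamel_basis V I) (n : nat).

Definition sym_val (w : sym_power e n) : tensor_power V n := subspace_val w.

HB.instance Definition _ := GRing.isLinear.Build f (sym_power e n)
  (tensor_power V n) *:%R sym_val (@subspace_val_linear _ _ _).

Lemma val_lincomb_sym_vec c :
  subspace_val (lincomb (sym_vec e n) c) = lincomb (sym_family e n) c.
Proof.
rewrite -[LHS]/(sym_val (lincomb (sym_vec e n) c)) /lincomb linear_sum.
by apply: eq_bigr => A _; rewrite linearZ.
Qed.

Lemma sym_vec_basis : is_basis (sym_vec e n).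
Proof.
split=> [c c0|w].
  apply/malgP => B; rewrite -(sym_coord_lincomb e B c) -val_lincomb_sym_vec c0.
  by rewrite mcoeff0 -[subspace_val _]/(sym_val _) !linear0.
have /asboolP[c wE] := subspace_valP w.
apply/asboolP; exists c; apply: val_inj.
by rewrite -[RHS]/(subspace_val _) val_lincomb_sym_vec.
Qed.

Lemma basis_coord_sym_vec (u : hamel_basis (sym_power e n) (sym_index I n)) w B :
    basis_vec u = sym_vec e n ->
  (basis_coord u w)@_B = tensor_coord e B (subspace_val w).
Proof.
move=> uE; rewrite -[in RHS](basis_coordK u w) uE val_lincomb_sym_vec.
by rewrite sym_coord_lincomb.
Qed.

End SymPowerBasis.

(** * Matrix coefficients of the tensor representation and stability *)

Section TensorAction.
Variables (f : fieldType) (L : lieAlgType f) (V : lmodType f) (T : lie_rep L V).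
Variables (d : Order.disp_t) (I : orderType d) (e : hamel_basis V I) (n : nat).
Implicit Types (a g : n.-tuple I) (l : L).

(** In the [k]-th term of the derivation, the untouched positions give a Kronecker delta of erasures
    and position [k] gives the form. *)
Lemma tensor_coord_act l a g :
  tensor_coord e g (tensor_act T l (basis_tensor e a))
  = \sum_(k < n | erase_entry k a == erase_entry k g)
      diagram_form T e (tnth a k) (tnth g k) l.
Proof.
rewrite tensor_actE /tensor_deriv linear_sum /= [RHS]big_mkcond.
apply: eq_bigr => k _; rewrite tensor_coordE (bigD1_ord k) //= !ffunE eqxx.
have -> : \prod_(j < n.-1) (basis_coord e (set_entry [ffun m => e (tnth a m)] k
              (T l (e (tnth a k))) (lift k j)))@_(tnth g (lift k j))
          = (erase_entry k a == erase_entry k g)%:R.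
  rewrite -prod_eqtuple; apply: eq_bigr => j _.
  by rewrite !ffunE eq_sym (negPf (neq_lift k j)) basis_coordE mcoeffU !tnth_mktuple.
by rewrite mulr_natr mulrb.
Qed.

(** The index [g] need not be sorted: stability compares the formula at permuted indices, while the
    diagram uses it at sorted ones. *)
Lemma tensor_coord_act_sym l a g :
  tensor_coord e g (tensor_act T l (sym_tensor e a))
  = \sum_(y <- g) \sum_(x <- undup a | perm_eq (x :: g) (y :: a))
      diagram_form T e x y l.
Proof.
rewrite /sym_tensor (linear_sum (tensor_act T l)) (linear_sum (tensor_coord e g)) /=.
under eq_bigr => b _ do rewrite tensor_coord_act.
rewrite (exchange_big_dep xpredT) //= big_tuple; apply: eq_bigr => k _.
exact: (sum_orbit_erase (fun x y => diagram_form T e x y l)).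
Qed.

Lemma tensor_act_basis_span l a :
  tensor_act T l (basis_tensor e a) \in lspan (basis_tensor (n := n) e).
Proof.
rewrite tensor_actE; apply: rpred_sum => k _; rewrite !ffunE.
set v := finfun _.
pose g (x : V) := tensor (set_entry v k x).
have gl : linear g by exact: tensor_multilinear.
(* With position [k] as a linear slot, expanding [T l] of its entry in the basis [e] yields a
   combination of basis tensors. *)
pose G := HB.pack g (GRing.isLinear.Build f _ _ _ g gl) : {linear V -> tensor_power V n}.
rewrite -[X in set_entry v k X](basis_coordK e) -[tensor _]/(G _).
rewrite /lincomb linear_sum; apply: rpred_sum => j _.
rewrite linearZ; apply: rpredZ.
have -> : G (e j) = basis_tensor e [tuple if m == k then j else tnth a m | m < n].
  congr tensor; apply/ffunP => m; rewrite !ffunE tnth_mktuple.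
  by case: eqP.
exact: mem_lspan.
Qed.

Lemma sym_power_stable : stable (lspan (sym_family e n)) (tensor_rep T n).
Proof.
move=> l w /asboolP[c ->]; rewrite /= /lincomb (linear_sum (tensor_act T l)).
apply: rpred_sum => A _; rewrite linearZ; apply: rpredZ.
apply: lspan_sym_family => [|a b ab].
  rewrite /sym_family /sym_tensor (linear_sum (tensor_act T l)).
  by apply: rpred_sum => b _; apply: tensor_act_basis_span.
rewrite !tensor_coord_act_sym (perm_big _ ab); apply: eq_bigr => y _.
apply: eq_bigl => x.
by have /permPl-> : perm_eq (x :: a) (x :: b) by rewrite perm_cons.
Qed.

End TensorAction.

Theorem proposition9 (f : fieldType) (L : lieAlgType f) (V : lmodType f)
    (T : lie_rep L V) (d : Order.disp_t) (I : orderType d)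
    (e : hamel_basis V I) (n : nat) :
  exists (T_stable : stable (lspan (sym_family e n)) (tensor_rep T n))
         (sym_basis : is_basis (sym_vec e n)),
    sym_graph (diagram T e) n
    = diagram (subrep T_stable) (HamelBasis sym_basis).
Proof.
exists (@sym_power_stable _ _ _ T _ _ e n), (sym_vec_basis e n).
set D := RHS.
have wE : weight (sym_graph (diagram T e) n) = weight D.
  apply/funext => A; apply/funext => B; apply/val_inj/funext => l.
  rewrite -[LHS]/(dual_eval l (sym_weight _ A B)) sym_weightE raddf_sum.
  rewrite -[RHS]/((basis_coord _ _)@_B) basis_coord_sym_vec //.
  rewrite -[RHS]/(tensor_coord e B (tensor_act T l (sym_tensor e A))).
  rewrite tensor_coord_act_sym; apply: eq_bigr => y _.
  by rewrite raddf_sum.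
(* Equal weights suffice: [edgeE] makes the edge relation a function of the weights, and its proofs
   are irrelevant. *)
move: wE; case: (sym_graph _ _) => ed w edE; case: D => ed' w' edE' /= ww.
have ede : ed = ed' by apply/funext => A; apply/funext => B; rewrite edE edE' ww.
case: _ / ww ede edE edE' => ede; case: _ / ede => ? ?.
by congr RWDGraph; apply: Prop_irrelevance.
Qed.
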